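(* Let $d<1$ and let $\beta$ be a real number such that $2^d<\beta<2$. Then there exist a constant $C>0$ and a subshift $X\subseteq\{0,1\}^{\mathbb{Z}}$ such that $h(X)\ge\log\beta$ and, for every connected pattern $\tau$ that appears in a configuration of $X$, $K(\tau)>d|\tau|-C$.
   Context: Let $\mathcal{A}=\{0,1\}$. A pattern over $\mathbb{Z}$ is an element $p\in\mathcal{A}^S$ where $S\subseteq\mathbb{Z}$ is non-empty and finite; its size is $|p|=|S|$. It is connected if its support is an interval $\{i,i+1,\ldots,j\}$ with $i\le j$; a connected pattern is identified with the binary string $p(i)p(i+1)\cdots p(j)$. A pattern $f$ with support $S$ appears in $x\in\mathcal{A}^{\mathbb{Z}}$ if there is $g\in\mathbb{Z}$ with $x(g+s)=f(s)$ for all $s\in S$. A subshift is a set of the form $\{x\in\mathcal{A}^{\mathbb{Z}}:\text{no }f\in\mathcal{F}\text{ appears in }x\}$ for some set of patterns $\mathcal{F}$. The topological entropy of a subshift $X$ is $h(X)=\lim_{n\to\infty}\frac{\log|\mathcal{G}^{(S_n)}|}{|S_n|}$, where $S_n=\{-n,\ldots,n\}$ and $\mathcal{G}^{(S)}$ is the set of $p\in\mathcal{A}^S$ that appear in some $x\in X$. $K(\tau)$ is the (plain) Kolmogorov complexity of the string $\tau$, i.e. the length of the shortest binary program (for a fixed optimal machine) that outputs $\tau$; in particular, for every integer $n\geq 0$ there are fewer than $2^n$ strings $\tau$ with $K(\tau)<n$ when $n\ge1$, and none when $n=0$. *)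

(* Defs.v *)
From HB Require Import structures.
From mathcomp Require Import all_boot all_order all_algebra finmap.
From mathcomp Require Import all_classical all_reals all_analysis.

Set Implicit Arguments.
Unset Strict Implicit.
Unset Printing Implicit Defensive.

Import Order.TTheory GRing.Theory Num.Theory.

Local Open Scope fset_scope.

(* Patterns and subshifts over Z on the alphabet bool *)

Definition config := int -> bool.

Record pattern := Pattern {
  supp : {fset int};
  supp_neq0 : supp != fset0;
  pval : {ffun supp -> bool} }.

Definition psize (p : pattern) : nat := #|` supp p|.

(* Stated for any f in A^S, so that it applies both to patterns and to the
   elements of the language on a fixed support. *)
Definition appears_on (S : {fset int}) (f : {ffun S -> bool}) (x : config) :=
  exists g : int, forall s : S, x (g + val s)%R = f s.

Definition appears (p : pattern) (x : config) := appears_on (pval p) x.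

Definition connected_pattern (p : pattern) :=
  exists i j : int,
    (i <= j)%R /\ forall k : int, k \in supp p = (i <= k <= j)%R.

(* The values of p in increasing order of the positions in its support; for a
   connected pattern on {i, ..., j} this is the string p(i) p(i+1) ... p(j).
   The default value false is never used. *)
Definition pattern_word (p : pattern) : seq bool :=
  [seq oapp (pval p) false (insub k) | k <- sort <=%R (enum_fset (supp p))].

Definition subshift (X : set config) :=
  exists F : set pattern,
    X = [set x : config | forall f, F f -> ~ appears f x]%classic.

(* S_n = {-n, ..., n} *)
Definition window (n : nat) : {fset int} :=
  [fset (k%:Z - n%:Z)%R | k in iota 0 n.*2.+1].

Definition language_card (X : set config) (S : {fset int}) : nat :=
  #|[pred p : {ffun S -> bool} | `[< exists2 x, X x & appears_on p x >]]|.

(* Extended-real valued: lne 0 = -oo, so the empty subshift has entropy -oo. *)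
Definition entropy (R : realType) (X : set config) : \bar R :=
  limn (fun n : nat =>
    (lne (language_card X (window n))%:R%:E
       / (#|` window n|)%:R%:E)%E).

(* Partial recursive functions N^n -> N, given by syntax and semantics *)

Inductive recf : nat -> Type :=
| rzero n : recf n
| rsucc : recf 1
| rproj n (i : 'I_n) : recf n
| rcomp n m (f : recf m) (gs : 'I_m -> recf n) : recf n
| rprec n (f : recf n) (g : recf n.+2) : recf n.+1
| rmin n (f : recf n.+1) : recf n.

(* [reval c v y] : the function denoted by c is defined at v with value y.
   - [rprec f g] at (x, w): h(0) = f(w) and h(k+1) = g(k, h(k), w), value h(x);
   - [rmin f] at v: least y such that f(y, v) = 0, with f(z, v) defined and
     nonzero for all z < y. *)
Fixpoint reval n (c : recf n) : n.-tuple nat -> nat -> Prop :=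
  match c in recf n return n.-tuple nat -> nat -> Prop with
  | rzero n => fun _ y => y = 0
  | rsucc => fun v y => y = (thead v).+1
  | rproj n i => fun v y => y = tnth v i
  | rcomp n m f gs => fun v y => exists w : m.-tuple nat,
      (forall i, reval (gs i) v (tnth w i)) /\ reval f w y
  | rprec n f g => fun v y => exists h : nat -> nat,
      [/\ reval f [tuple of behead v] (h 0),
          forall k, k < thead v ->
            reval g [tuple of k :: h k :: behead v] (h k.+1)
        & y = h (thead v)]
  | rmin n f => fun v y =>
      reval f [tuple of y :: v] 0 /\
      forall z, z < y -> exists t, reval f [tuple of z :: v] t.+1
  end.

(* Bijective base-2 numeration, a bijection between binary strings and nat *)
Fixpoint bin_code (s : seq bool) : nat :=
  if s is b :: s' then (bin_code s').*2 + b.+1 else 0.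

(* Machines are partial functions on binary strings; None means divergence. *)
Definition partial_computable (M : seq bool -> option (seq bool)) :=
  exists c : recf 1, forall (p s : seq bool),
    M p = Some s <-> reval c [tuple bin_code p] (bin_code s).

(* Additive optimality: K_U <= K_V + O(1) for every machine V. *)
Definition optimal (U : seq bool -> option (seq bool)) :=
  partial_computable U /\
  forall V, partial_computable V ->
    exists c : nat, forall p s, V p = Some s ->
      exists2 q, U q = Some s & size q <= size p + c.

Record optimal_machine := OptimalMachine {
  machine :> seq bool -> option (seq bool);
  machine_optimal : optimal machine }.

Lemma bin_code_inj : injective bin_code.
Proof.
have oddE (b : bool) n : odd (n.*2 + b.+1) = ~~ b.
  by rewrite oddD odd_double; case: b.
elim=> [|b s IHs] [|b' s'] //=; first by rewrite addnS.
  by rewrite addnS.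
move=> e; have bb : b = b'.
  by apply: negb_inj; rewrite -(oddE b (bin_code s)) e oddE.
by move: e; rewrite bb => /addIn /double_inj /IHs ->.
Qed.

Lemma partial_computable_id : partial_computable Some.
Proof.
exists (rproj ord0) => p s /=; rewrite (tnth_nth 0) /=.
by split=> [[->] //|/bin_code_inj ->].
Qed.

Lemma has_program (U : optimal_machine) (s : seq bool) :
  exists n, `[< exists2 p, U p = Some s & size p = n >].
Proof.
have [_ /(_ _ partial_computable_id) [c Uc]] := machine_optimal U.
have [q Uq _] := Uc s s erefl.
by exists (size q); apply/asboolP; exists q.
Qed.

(* Plain Kolmogorov complexity: the least length of a U-program for s *)
Definition K (U : optimal_machine) (s : seq bool) : nat :=
  ex_minn (has_program U s).

(* Main.v *)
Require Import Defs.
From mathcomp Require Import all_boot all_order all_algebra finmap.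
From mathcomp Require Import all_classical all_reals all_analysis.
From mathcomp Require Import zify lra ring.
Import Order.TTheory GRing.Theory Num.Theory.
Import numFieldNormedType.Exports.
Local Open Scope ring_scope.

Set Implicit Arguments.
Unset Strict Implicit.
Unset Printing Implicit Defensive.

(* Forbid the words w with K(w) <= d|w| - c. Their number a_m
   in length m is at most 2^(1 - c) (2^d)^m, so for c large
   sum_m a_m beta^(1 - m) <= 2 - beta, and by induction the number L_n of words
   without forbidden factor satisfies L_(n+1) >= beta L_n: an extension of an
   admissible word by one letter fails only because of a forbidden suffix, which
   is preceded by an admissible word.
   To pass to words occurring in the subshift, cut an admissible word of length
   N + kn + N into blocks: the k inner blocks of length n are admissibly
   extendable by N letters on both sides, so beta^(kn + 2N) <= 4^N e_N(n)^k
   for the number e_N(n) of such blocks, and k -> oo gives e_N(n) >= beta^n for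
   all N, whence the same bound for words extendable by any number of letters.
   By a Koenig argument these are factors of points of X. Fekete's
   lemma gives the existence of the limit that defines the entropy. *)

(** * Counting binary words of a given length *)

Definition word_card (n : nat) (P : pred (seq bool)) : nat :=
  #|[pred w : n.-tuple bool | P w]|.

Lemma leq_word_card n (P Q : pred (seq bool)) :
  (forall w, size w = n -> P w -> Q w) -> (word_card n P <= word_card n Q)%N.
Proof.
move=> PQ; apply: subset_leq_card; apply/fintype.subsetP => w.
by rewrite !inE; apply: PQ; rewrite size_tuple.
Qed.

Lemma word_card_predT n : word_card n predT = (2 ^ n)%N.
Proof. by rewrite -card_bool -card_tuple; apply: eq_card. Qed.

Lemma word_card_predU n P Q :
  (word_card n [predU P & Q] <= word_card n P + word_card n Q)%N.
Proof.
rewrite /word_card -cardUI; apply: leq_trans (leq_addr _ _).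
by apply: subset_leq_card; apply/fintype.subsetP => w; rewrite !inE.
Qed.

Lemma word_card_bigU n m (P : nat -> pred (seq bool)) :
  (word_card n [pred w | [exists i : 'I_m, P i w]]
   <= \sum_(i < m) word_card n (P i))%N.
Proof.
elim: m => [|m IHm].
  rewrite big_ord0 leqn0; apply/eqP/eq_card0 => w; rewrite !inE.
  by apply/existsP => -[[]].
rewrite big_ord_recr /=; apply: leq_trans (leq_add IHm (leqnn _)).
apply: leq_trans (word_card_predU _ _ _); apply: leq_word_card => w _.
case/existsP => i Pi; rewrite !inE; case: (ltnP i m) => im.
  by apply/orP; left; apply/existsP; exists (Ordinal im).
by apply/orP; right; rewrite (_ : m = i) //; have := ltn_ord i; lia.
Qed.

Lemma word_card_cat m n P Q :
  word_card (m + n) [pred w | P (take m w) && Q (drop m w)]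
  = (word_card m P * word_card n Q)%N.
Proof.
rewrite /word_card -cardX.
pose f (u : m.-tuple bool * n.-tuple bool) := cat_tuple u.1 u.2.
have f_inj : injective f.
  move=> [a b] [a' b'] /(congr1 (@tval _ _)) /= /eqP.
  rewrite eqseq_cat ?size_tuple // => /andP[/eqP aa /eqP bb].
  by congr (_, _); apply: val_inj.
rewrite -(fintype.card_image f_inj); apply: eq_card => w.
rewrite !inE; apply/idP/fintype.imageP => [|[[a b]]].
  case/andP => Pw Qw.
  have sa : size (take m w) == m by rewrite size_takel ?size_tuple ?leq_addr.
  have sb : size (drop m w) == n by rewrite size_drop size_tuple addKn.
  exists (Tuple sa, Tuple sb); first by rewrite !inE; apply/andP.
  by apply: val_inj; rewrite /= cat_take_drop.
rewrite !inE /= => /andP[Pa Qb] ->.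
by rewrite /= take_size_cat ?drop_size_cat ?size_tuple // Pa.
Qed.

(** * Counting words of low complexity *)

Lemma bin_code_lt (s : seq bool) : ((bin_code s).+1 < 2 ^ (size s).+1)%N.
Proof.
(* The letter [true] adds 2 to the doubled code, so the induction closes only with the sharp bound,
   attained on words of letters [true]. *)
elim: s => [//|b s IHs] /=.
by rewrite expnS -muln2; case: b => /=; rewrite ?expnS in IHs *; lia.
Qed.

Lemma K_program (U : optimal_machine) (s : seq bool) :
  exists2 p, U p = Some s & size p = K U s.
Proof. by rewrite /K; case: ex_minnP => n /asboolP. Qed.

(** A program determines its output, so sending a word to the code of a chosen shortest program is
    injective, with codes below [2 ^ k.+1]. *)
Lemma word_card_K (U : optimal_machine) n k :
  (word_card n [pred w | (K U w <= k)%N] <= 2 ^ k.+1)%N.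
Proof.
have /boolp.choice[prog progP] (s : seq bool) :
    exists p, U p = Some s /\ size p = K U s.
  by have [p] := K_program U s; exists p.
pose f (w : n.-tuple bool) : 'I_(2 ^ k.+1).-1.+1 := inord (bin_code (prog w)).
have lt_prog (w : seq bool) : (K U w <= k)%N -> (bin_code (prog w) < 2 ^ k.+1)%N.
  move=> Kw; apply: ltnW; apply: leq_trans (bin_code_lt _) _.
  by rewrite leq_exp2l // ltnS; have [_ ->] := progP w.
suff f_inj : {in [pred w : n.-tuple bool | (K U w <= k)%N] &, injective f}.
  by have := leq_card_in _ _ f_inj; rewrite card_ord prednK ?expn_gt0.
move=> w w'; rewrite !inE => /lt_prog lw /lt_prog lw'.
move=> /(congr1 (@nat_of_ord _)); rewrite !inordK ?prednK ?expn_gt0 //.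
move=> /bin_code_inj e; apply: val_inj.
have [p1 _] := progP w; have [p2 _] := progP w'.
by apply: Some_inj; rewrite -p1 -p2 e.
Qed.

(** * Growth of the set of admissible words *)

Definition avoids (bad : pred (seq bool)) (w : seq bool) : bool :=
  `[< forall s u t, w = s ++ u ++ t -> ~~ bad u >].

Lemma avoids_infix bad s u t : avoids bad (s ++ u ++ t) -> avoids bad u.
Proof.
move=> /asboolP aw; apply/asboolP => s' v t' e.
by apply: (aw (s ++ s') v (t' ++ t)); rewrite e !catA.
Qed.

(** The left side counts words of length [n.+1] whose first [n] letters are admissible; [j] is the
    length of the admissible prefix before a forbidden suffix, which is non-empty because [[::]] is
    not forbidden. *)
Lemma avoids_extension bad n : ~~ bad [::] ->
  (2 * word_card n (avoids bad) <= word_card n.+1 (avoids bad)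
   + \sum_(j < n.+1) word_card j (avoids bad) * word_card (n.+1 - j) bad)%N.
Proof.
move=> bad0; rewrite mulnC -[2%N]/(2 ^ 1)%N -(word_card_predT 1).
rewrite -word_card_cat addn1.
pose B j : pred (seq bool) := [pred w | avoids bad (take j w) && bad (drop j w)].
apply: (@leq_trans (word_card n.+1
    [predU avoids bad & [pred w | [exists j : 'I_n.+1, B j w]]])).
  apply: leq_word_card => w sw /=; rewrite andbT /= => aw.
  rewrite !inE -!topredE /=; case: (boolP (avoids bad w)) => //= /asboolPn naw.
  apply: boolp.contrapT => h; apply: naw => s u t e; apply/negP => badu.
  (* If [t] is empty, the forbidden factor [u] is a suffix; otherwise it lies within the first [n]
     letters, which are admissible. *)
  case/lastP: t => [|t b] in e.
    rewrite cats0 in e; have [sn|ns] := ltnP (size s) n.+1.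
      apply: h; apply/existsP; exists (Ordinal sn) => /=.
      rewrite /B /= e drop_size_cat // badu andbT take_size_cat //.
      apply: (@avoids_infix _ [::] _ (take (n - size s) u)).
      by move: aw; rewrite e take_cat ltnNge -ltnS sn.
    have /eqP : size u = 0%N by move: sw; rewrite e size_cat; lia.
    by rewrite size_eq0 => /eqP u0; move: bad0; rewrite -u0 badu.
  apply: (negP (elimT (asboolP _) aw s u t _)) => //.
  rewrite e -!rcons_cat -cats1 take_size_cat //.
  by move: sw; rewrite e -!rcons_cat size_rcons => -[].
apply: leq_trans (word_card_predU _ _ _) _; rewrite leq_add2l.
apply: leq_trans (word_card_bigU _ _ _) _.
apply: leq_sum => j _; rewrite -word_card_cat subnKC //.
exact: ltnW (ltn_ord j).
Qed.

Lemma avoids_nil bad : ~~ bad [::] -> avoids bad [::].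
Proof. by move=> bad0; apply/asboolP => -[|//] [|//]. Qed.

Lemma geometric_sum_le (R : realFieldType) (q : R) n :
  0 <= q < 1 -> \sum_(i < n) q ^+ i <= (1 - q)^-1.
Proof.
move=> /andP[q0 q1]; rewrite -[leRHS]mul1r ler_pdivlMr ?subr_gt0 //.
have := subrX1 q n; have := exprn_ge0 n q0.
by set s := \sum_(i < n) _; lra.
Qed.

Lemma avoids_growth (R : realFieldType) bad (A D beta : R) :
  0 <= A -> 0 < D < beta -> A * D / (1 - D / beta) <= 2 - beta ->
  ~~ bad [::] -> (forall m, (word_card m bad)%:R <= A * D ^+ m) ->
  forall n, beta ^+ n <= (word_card n (avoids bad))%:R.
Proof.
move=> A0 /andP[D0 Db] hC bad0 hbad n.
have b0 : 0 < beta := lt_trans D0 Db.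
pose L n : R := (word_card n (avoids bad))%:R.
have q01 : 0 <= D / beta < 1.
  by rewrite ltr_pdivrMr // mul1r Db andbT divr_ge0 // ltW.
(* All earlier lengths [k] are compared with [m] at once: the error sum at step [m.+1] involves
   every [L j] with [j <= m]. *)
suff P m : forall k, (k <= m)%N -> beta ^+ (m - k) * L k <= L m.
  have := P n 0%N (leq0n _); rewrite subn0; apply: le_trans.
  apply: ler_peMr; first by rewrite exprn_ge0 ?ltW.
  rewrite /L ler1n; apply/fintype.card_gt0P; exists [tuple]; exact: avoids_nil.
elim: m => [|m IHm] k km.
  by move: km; rewrite leqn0 => /eqP ->; rewrite mul1r.
have [->|{}km] : k = m.+1 \/ (k <= m)%N by lia.
  by rewrite subnn mul1r.
rewrite subSn // exprS -mulrA.
apply: (@le_trans _ _ (beta * L m)); first by rewrite ler_pM2l ?IHm.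
have := avoids_extension m bad0; rewrite -(ler_nat R) natrD natrM natr_sum -!/(L _).
set S := \sum_(_ < _) _ => hS.
suff : S <= L m * (2 - beta) by lra.
apply: (@le_trans _ _ (L m * (A * D * \sum_(i < m.+1) (D / beta) ^+ i))).
  (* Reversing the geometric sum gives the exponent [m - j], one less than the length of the
     forbidden suffix; the remaining power of [D] is the one in [A * D]. *)
  rewrite (reindex_inj rev_ord_inj) /S !mulr_sumr; apply: ler_sum => j _ /=.
  rewrite subSS natrM -/(L j) subSn ?(ltnSE (ltn_ord j)) //.
  have Lj : L j <= L m * beta ^- (m - j).
    by rewrite ler_pdivlMr ?exprn_gt0 // mulrC IHm // (ltnSE (ltn_ord j)).
  apply: (le_trans (ler_pM _ _ Lj (hbad _))) => //.
  by rewrite exprS expr_div_n; lra.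
rewrite ler_wpM2l // (le_trans _ hC) // ler_wpM2l ?geometric_sum_le //.
by rewrite mulr_ge0 // ltW.
Qed.

(** * Admissible words with long extensions on both sides *)

Lemma ler_of_exp_le (R : realType) (x y c B : R) :
  0 < x -> 0 <= y -> 0 < c -> (forall k, x ^+ k * c <= B * y ^+ k) -> x <= y.
Proof.
(* If [y < x], then [B * (y / x) ^+ k] tends to 0 while staying at least [c > 0]. *)
move=> x0 y0 c0 h; rewrite leNgt; apply/negP => yx.
have q1 : `|y / x| < 1.
  by rewrite ger0_norm ?ltr_pdivrMr ?mul1r // divr_ge0 // ltW.
have hlim : (B * (y / x) ^+ k @[k --> \oo] --> B * 0)%classic.
  by apply: cvgMl_tmp; exact: cvg_expr.
have : c <= B * 0; last by lra.
rewrite -(cvg_lim (@Rhausdorff R) hlim) //; apply: limr_ge; first exact: cvgP hlim.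
apply: nearW => k /=; rewrite expr_div_n mulrA ler_pdivlMr ?exprn_gt0 //.
by rewrite mulrC.
Qed.

Definition extendable bad N (w : seq bool) : bool :=
  `[< exists u v, [/\ size u = N, size v = N & avoids bad (u ++ w ++ v)] >].

Definition left_extendable bad N (w : seq bool) : bool :=
  `[< exists2 u, size u = N & avoids bad (u ++ w) >].

(** Peel off the first block of length [n]: at least [N] letters follow it, so it is extendable, and
    what follows is again left extendable. The last [N] letters are counted trivially. *)
Lemma word_card_left_extendable bad N n k :
  (word_card (k * n + N) (left_extendable bad N)
   <= word_card n (extendable bad N) ^ k * 2 ^ N)%N.
Proof.
elim: k => [|k IHk].
  by rewrite mul1n -word_card_predT; apply: leq_word_card.
rewrite mulSn -addnA expnS -mulnA.
apply: leq_trans (leq_mul (leqnn _) IHk); rewrite -word_card_cat.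
apply: leq_word_card => w sw /asboolP[u su auw]; apply/andP; split.
  apply/asboolP; exists u, (take N (drop n w)); split => //.
    by rewrite size_takel // size_drop; lia.
  apply: (@avoids_infix _ [::] _ (drop N (drop n w))).
  by rewrite /= -!catA !cat_take_drop.
have suw : size (u ++ take n w) = (N + n)%N.
  by rewrite size_cat su size_takel //; lia.
(* The new left context is the last [N] letters of [u] followed by the block, whether or not [n]
   exceeds [N]. *)
apply/asboolP; exists (drop n (u ++ take n w)).
  by rewrite size_drop suw addnK.
apply: (@avoids_infix _ (take n (u ++ take n w)) _ [::]).
by rewrite cats0 catA cat_take_drop -catA cat_take_drop.
Qed.

Lemma word_card_extendable (R : realType) bad (beta : R) N n : 0 < beta ->
  (forall m, beta ^+ m <= (word_card m (avoids bad))%:R) ->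
  beta ^+ n <= (word_card n (extendable bad N))%:R.
Proof.
move=> b0 h.
apply: (@ler_of_exp_le _ _ _ (beta ^+ (N + N)) (2 ^+ N * 2 ^+ N)) => [|//||k].
- by rewrite exprn_gt0.
- by rewrite exprn_gt0.
rewrite -exprM -exprD; apply: le_trans (h _) _.
rewrite -!natrX -!natrM ler_nat mulnAC -mulnA.
apply: leq_trans (leq_mul (leqnn _) (word_card_left_extendable _ _ _ _)).
rewrite -word_card_predT -word_card_cat [(n * k)%N]mulnC addnCA.
apply: leq_word_card => w sw aw /=; apply/asboolP.
exists (take N w); first by rewrite size_takel; lia.
by rewrite cat_take_drop.
Qed.

Lemma extendableS bad N w : extendable bad N.+1 w -> extendable bad N w.
Proof.
move=> /asboolP[u [v []]]; case: u => [//|a u] [su].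
case/lastP: v => [//|v b]; rewrite size_rcons => -[sv] auv.
apply/asboolP; exists u, v; split => //.
by apply: (@avoids_infix _ [:: a] _ [:: b]); rewrite /= -!catA cats1.
Qed.

Lemma extendable_leq bad M N w :
  (M <= N)%N -> extendable bad N w -> extendable bad M w.
Proof.
by move=> /subnK <-; elim: (N - M)%N => // k IHk /extendableS.
Qed.

(** The extensions for different [N] need not be compatible; compactness reconciles them below. *)
Definition biextendable bad w : bool := `[< forall N, extendable bad N w >].

Lemma word_card_biextendable (R : realType) bad (beta : R) n : 0 < beta ->
  (forall m, beta ^+ m <= (word_card m (avoids bad))%:R) ->
  beta ^+ n <= (word_card n (biextendable bad))%:R.
Proof.
move=> b0 h.
have /boolp.choice[f fP] (w : n.-tuple bool) :
    exists N, extendable bad N w -> biextendable bad w.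
  case: (boolP (biextendable bad w)) => [bw|/asboolPn/existsNP[N nN]].
    by exists 0%N.
  by exists N => /nN.
(* Each word of length [n] that is not biextendable fails at some [f w]; there are finitely many
   words, so one [N] detects all failures. *)
pose N := \max_(w : n.-tuple bool) f w.
apply: le_trans (word_card_extendable N _ b0 h) _; rewrite ler_nat.
apply: subset_leq_card; apply/fintype.subsetP => w eNw.
by apply: fP; apply: extendable_leq eNw; exact: leq_bigmax.
Qed.

(** * From biextendable words to configurations *)

Definition subword (x : config) (g : int) (m : nat) : seq bool :=
  mkseq (fun i => x (g + i%:Z)) m.

Lemma size_subword x g m : size (subword x g m) = m.
Proof. exact: size_mkseq. Qed.

Lemma subwordD x g m n :
  subword x g (m + n) = subword x g m ++ subword x (g + m%:Z) n.
Proof.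
rewrite /subword /mkseq iotaD map_cat add0n; congr (_ ++ _).
rewrite -[X in iota X]addn0 iotaDl -map_comp; apply: eq_map => i /=.
by rewrite PoszD addrA.
Qed.

(** Pigeonhole on the four pairs of letters: if each failed at some length, the pair adjacent to [w]
    in an extension by one letter more than the largest of these lengths would be contradictory. *)
Lemma biextendableS bad w : biextendable bad w ->
  exists ab : bool * bool, biextendable bad (ab.1 :: rcons w ab.2).
Proof.
move=> /asboolP bw; apply: contrapT => /forallNP nh.
have /boolp.choice[f fP] (ab : bool * bool) :
    exists N, ~ extendable bad N (ab.1 :: rcons w ab.2).
  by apply/existsNP => h; apply: (nh ab); apply/asboolP.
pose N := \max_ab f ab.
have /asboolP[u [v [su sv auv]]] := bw N.+1.
case/lastP: u su auv => [//|u a]; rewrite size_rcons => -[su].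
case: v sv => [//|b v] [sv] auv.
apply: (fP (a, b)); apply: (@extendable_leq _ _ N); first exact: leq_bigmax.
apply/asboolP; exists u, v; split => //.
by move: auv; rewrite -cats1 -[rcons w b]cats1 -!catA /= -catA.
Qed.

Lemma biextendable_config bad w : biextendable bad w ->
  exists x, (forall g m, ~~ bad (subword x g m)) /\
            exists g, w = subword x g (size w).
Proof.
move=> bw.
have /boolp.choice[f fP] (v : seq bool) : exists ab : bool * bool,
    biextendable bad v -> biextendable bad (ab.1 :: rcons v ab.2).
  case: (boolP (biextendable bad v)) => [/biextendableS[ab h]|_].
    by exists ab.
  by exists (true, true).
pose W k := iter k (fun v => (f v).1 :: rcons v (f v).2) w.
have bW k : biextendable bad (W k) by elim: k => // k /fP.
have sW k : size (W k) = (size w + k.*2)%N.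
  by elim: k => [|k IHk]; rewrite ?addn0 //= size_rcons IHk; lia.
have nthW k m i : (i < size (W k))%N ->
    nth false (W (m + k)%N) (m + i) = nth false (W k) i.
  move=> ik; elim: m => // m IHm.
  rewrite !addSn /= nth_rcons -/(W (m + k)%N) IHm ifT //.
  by move: ik; rewrite !sW; lia.
(* [W k] is meant to occupy the positions from [- k] on, so level [|z| + 1] covers [z], at index
   [z + |z| + 1]. *)
pose x : config := fun z => nth false (W `|z|%N.+1) `|(z + `|z|%N.+1%:Z)%R|%N.
have xW k i : (i < size (W k))%N -> x (i%:Z - k%:Z) = nth false (W k) i.
  move=> ik; rewrite /x; set z : int := i%:Z - k%:Z; set j := `|(z + _)%R|%N.
  have jk : (j + k = i + `|z|%N.+1)%N by rewrite /j /z; lia.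
  have js : (j < size (W `|z|%N.+1))%N by rewrite sW /j /z; lia.
  have [zk|kz] := leqP `|z|%N.+1 k.
    rewrite -(nthW _ (k - `|z|.+1)%N) // subnK //; congr nth.
    by move: jk zk; lia.
  rewrite -(nthW _ (`|z|.+1 - k)%N i) // subnK 1?ltnW //; congr nth.
  by move: jk kz; lia.
have Wx k : W k = subword x (- k%:Z) (size (W k)).
  apply: (@eq_from_nth _ false) => [|i ik]; rewrite ?size_subword //.
  by rewrite nth_mkseq // addrC xW.
exists x; split; last by exists (- 0%:Z); exact: (Wx 0%N).
move=> g m; pose k := (`|g| + m)%N.
(* Extendability by 0 letters says that [W k] itself is admissible; this [k] is large enough for
   [W k] to cover the given subword. *)
have /asboolP/(_ 0%N)/asboolP[u [v [/size0nil-> /size0nil->]]] := bW k.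
rewrite /= cats0 => /asboolP aW.
have [a [b [sk gk]]] : exists a b : nat,
    size (W k) = (a + (m + b))%N /\ - k%:Z + a%:Z = g.
  exists `|(g + k%:Z)%R|%N, (size (W k) - m - `|(g + k%:Z)%R|)%N.
  by rewrite sW /k; split; lia.
apply: (aW (subword x (- k%:Z) a) _ (subword x (g + m%:Z) b)).
by rewrite Wx sk !subwordD gk.
Qed.

Lemma pattern_word_subword (f : pattern) (x : config) :
  connected_pattern f -> appears f x ->
  exists g, pattern_word f = subword x g (psize f).
Proof.
move=> [i [j [ij fP]]] [g gP].
have e : sort <=%R (enum_fset (supp f)) = [seq i + k%:Z | k <- iota 0 `|j - i|.+1].
  apply: lt_sorted_eq.
  - by rewrite sort_lt_sorted fset_uniq.
  - rewrite sorted_map; apply: (sub_sorted _ (iota_ltn_sorted _ _)).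
    by move=> a b /=; rewrite ltrD2l ltz_nat.
  - move=> k; rewrite mem_sort -[_ \in enum_fset _]/(k \in supp f) fP.
    apply/idP/mapP => [/andP[ik kj]|[a]]; last first.
      by rewrite mem_iota => aij ->; lia.
    by exists `|(k - i)%R|%N; rewrite ?mem_iota; lia.
have sf : psize f = `|j - i|.+1.
  by rewrite /psize -(size_sort <=%R) e size_map size_iota.
exists (g + i); rewrite /pattern_word e sf /subword /mkseq -map_comp.
apply/eq_in_map => k; rewrite mem_iota => kij /=.
have ks : i + k%:Z \in supp f by rewrite fP; lia.
by rewrite insubT /= -gP /= addrA.
Qed.

(** * Language counts and entropy *)

Definition occurs (X : set config) (w : seq bool) : bool :=
  `[< exists2 x, X x & exists g, w = subword x g (size w) >].

Lemma occurs_cat X u v : occurs X (u ++ v) -> occurs X u && occurs X v.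
Proof.
move=> /asboolP[x Xx [g]]; rewrite size_cat subwordD => /eqP.
rewrite eqseq_cat ?size_subword // => /andP[/eqP eu /eqP ev].
apply/andP; split; apply/asboolP; exists x => //; first by exists g.
by exists (g + (size u)%:Z).
Qed.

Lemma word_card_occursD X m n :
  (word_card (m + n) (occurs X)
   <= word_card m (occurs X) * word_card n (occurs X))%N.
Proof.
rewrite -word_card_cat; apply: leq_word_card => w _.
by rewrite -{1}(cat_take_drop m w) => /occurs_cat.
Qed.

Lemma card_window n : #|` window n| = n.*2.+1.
Proof.
rewrite /window card_in_imfset; last first.
  by move=> a b _ _ /eqP; rewrite (inj_eq (addIr _)) => /eqP[].
rewrite -[LHS]/(size (undup (iota 0 n.*2.+1))).
by rewrite undup_id ?iota_uniq // size_iota.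
Qed.

Lemma mem_window n (z : int) : (z \in window n) = (- n%:Z <= z <= n%:Z).
Proof.
apply/imfsetP/idP => [[k kn ->]|nz].
  by have : k \in iota 0 n.*2.+1 := kn; rewrite mem_iota; lia.
exists `|(z + n%:Z)%R|%N; last by lia.
by rewrite -[in_mem _ _]/(_ \in iota 0 n.*2.+1) mem_iota; lia.
Qed.

(** Translating positions by [n] matches patterns on the window with words of length [n.*2.+1];
    occurrences may start anywhere, so the translation is absorbed by [g]. *)
Lemma language_card_window X n :
  language_card X (window n) = word_card n.*2.+1 (occurs X).
Proof.
pose f (t : n.*2.+1.-tuple bool) : {ffun window n -> bool} :=
  [ffun s : window n => nth false t `|(val s + n%:Z)%R|%N].
have winP (i : nat) : (i < n.*2.+1)%N -> i%:Z - n%:Z \in window n.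
  by rewrite mem_window => ?; lia.
have f_inj : injective f.
  move=> t u /ffunP tu; apply/val_inj/(@eq_from_nth _ false).
    by rewrite !size_tuple.
  move=> i; rewrite size_tuple => /winP iw.
  by have := tu [` iw]%fset; rewrite !ffunE /= subrK.
rewrite /language_card /word_card -(fintype.card_image f_inj).
apply: eq_card => p; rewrite !inE; apply/asboolP/fintype.imageP.
  move=> [x Xx [g gP]].
  have sx : size (subword x (g - n%:Z) n.*2.+1) == n.*2.+1 by rewrite size_subword.
  exists (Tuple sx).
    by apply/asboolP; exists x => //; exists (g - n%:Z); rewrite size_tuple.
  apply/ffunP => s; rewrite ffunE /= -gP.
  have := fsvalP s; rewrite mem_window -[fsval s]/(val s).
  by move: (val s) => z zn; rewrite nth_mkseq; [congr x|]; lia.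
move=> [t /asboolP[x Xx [g tg]] ->]; exists x => //; exists (g + n%:Z) => s.
have := fsvalP s; rewrite mem_window -[fsval s]/(val s) ffunE tg size_tuple.
by move: (val s) => z zn; rewrite nth_mkseq; [congr x|]; lia.
Qed.

(** Choose [M] with [u M / M] close to the infimum and divide a large index by [M]: the quotient
    contributes at most this ratio, the remainder a bounded amount. Indices are shifted by one to
    avoid division by 0. *)
Lemma fekete (R : realType) (u : nat -> R) :
  (forall n, 0 <= u n) -> (forall m n, u (m + n)%N <= u m + u n) ->
  (u n.+1 / n.+1%:R @[n --> \oo]
   --> inf (range (fun n => u n.+1 / n.+1%:R)))%classic.
Proof.
move=> u0 uD; set V := range _; set l := inf V.
have lbV : lbound V 0 by move=> _ [n _ <-]; rewrite divr_ge0.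
have infV : has_inf V.
  by split; [exists (u 1%N / 1); exists 0%N | exists 0].
have lV n : l <= u n.+1 / n.+1%:R by apply: ge_inf; [exists 0 | exists n].
have uM r q m : u (q * m + r)%N <= q%:R * u m + u r.
  elim: q => [|q IHq]; first by rewrite mul0r add0r.
  by rewrite mulSn -addnA -natr1; have := uD m (q * m + r)%N; lra.
suff key (e : R) : 0 < e ->
    (\forall n \near \oo, u n.+1 / n.+1%:R < l + e)%classic.
  apply/cvgrPdist_lt => e e0; have := key e e0; apply: filterS => n hn.
  by rewrite distrC ger0_norm ?subr_ge0 ?lV // ltrBlDl.
move=> e0; have e20 : 0 < e / 2 by rewrite divr_gt0.
have [_ [m _ <-]] := inf_adherent e20 infV.
rewrite -/l; set M := m.+1 => hm.
(* [B] bounds [u r] for every remainder [r]; [u 0] appears since it need not vanish. *)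
pose B := u 0%N + M%:R * u 1%N.
exists (Num.truncn (B / (e / 2))) => // n /= hn.
have n0 : 0 < n.+1%:R :> R by rewrite ltr0n.
have hB : B < e / 2 * n.+1%:R.
  rewrite mulrC -ltr_pdivrMr //; apply: lt_le_trans (truncnS_gt _) _.
  by rewrite ler_nat ltnS.
rewrite ltr_pdivrMr //.
suff : u n.+1 <= u M / M%:R * n.+1%:R + B.
  have : u M / M%:R * n.+1%:R < (l + e / 2) * n.+1%:R by rewrite ltr_pM2r.
  by move: hB; move: (n.+1%:R : R) => N; lra.
rewrite {1}(divn_eq n.+1 M); set q := (_ %/ _)%N; set r := (_ %% _)%N.
have hr : u r <= B.
  have rM : (r <= M)%N by rewrite ltnW // ltn_mod.
  have := uM 0%N r 1%N; rewrite muln1 addn0.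
  have : r%:R * u 1%N <= M%:R * u 1%N by rewrite ler_wpM2r // ler_nat.
  by rewrite /B; lra.
have hq : q%:R * u M <= u M / M%:R * n.+1%:R.
  rewrite mulrC -mulrA ler_wpM2l // mulrC ler_pdivlMr ?ltr0n //.
  by rewrite -natrM ler_nat leq_divM.
by have := uM r q M; lra.
Qed.

Lemma double_cvgny : (n.*2 @[n --> \oo] --> \oo)%classic.
Proof. by apply/cvgnyPge => N; exists N => // n /=; lia. Qed.

Lemma entropy_ge (R : realType) (X : set config) (beta : R) : 0 < beta ->
  (forall n, beta ^+ n <= (word_card n (occurs X))%:R) ->
  ((ln beta)%:E <= entropy R X)%E.
Proof.
move=> b0 h; pose u n : R := ln (word_card n (occurs X))%:R.
have c0 n : 0 < (word_card n (occurs X))%:R :> R.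
  exact: lt_le_trans (exprn_gt0 _ b0) (h n).
have ub n : n%:R * ln beta <= u n.
  by rewrite mulr_natl -lnXn // ler_ln ?posrE ?exprn_gt0.
have u0 n : 0 <= u n by rewrite ln_ge0 // ler1n -(ltr0n R).
have uD m n : u (m + n)%N <= u m + u n.
  rewrite -lnM ?posrE // ler_ln ?posrE ?mulr_gt0 //.
  by rewrite -natrM ler_nat word_card_occursD.
(* Windows have odd size, so the entropy is the limit along the even-indexed subsequence of the
   shifted quotients. *)
have := cvg_comp _ _ double_cvgny (fekete u0 uD); set l := inf _ => hl.
have ll : ln beta <= l.
  apply: lb_le_inf => [|_ [n _ <-]]; first by exists (u 1%N / 1); exists 0%N.
  by rewrite ler_pdivlMr ?ltr0n // mulrC.
rewrite /entropy.
under eq_fun do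
  rewrite language_card_window card_window lne_EFin // inver pnatr_eq0 /= -EFinM.
rewrite (_ : limn _ = l%:E) ?lee_fin //.
by apply: cvg_lim => //; apply: cvg_EFin => //; exact: nearW.
Qed.

(** * Compressible words and the final construction *)

Lemma size_pattern_word (f : pattern) : size (pattern_word f) = psize f.
Proof. by rewrite size_map size_sort. Qed.

(** With [t = d m - c], no word qualifies if [t < 0]; otherwise the complexity is at most the
    integer part of [t], and the count is at most [2 * 2 ^ t]. *)
Lemma word_card_compressible (R : realType) (U : optimal_machine) (d : R) c m :
  (word_card m [pred w | ((K U w)%:R <= d * (size w)%:R - c%:R)%R])%:R
  <= 2 / 2 ^+ c * (2 `^ d) ^+ m.
Proof.
set t := d * m%:R - c%:R.
have -> : 2 / 2 ^+ c * (2 `^ d) ^+ m = 2 * 2 `^ t.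
  rewrite /t powRD; last by rewrite pnatr_eq0 implybT.
  by rewrite powRN !powR_mulrn // powRrM powR_mulrn ?powR_ge0 //; ring.
have [t0|t0] := ltP t 0.
  rewrite [word_card _ _](_ : _ = 0%N) ?mulr_ge0 ?powR_ge0 //.
  apply: eq_card0 => w; rewrite !inE size_tuple; apply/negbTE.
  by rewrite -ltNge (lt_le_trans t0).
apply: (@le_trans _ _ (2 ^ (Num.truncn t).+1)%:R).
  rewrite ler_nat; apply: leq_trans (word_card_K U m _).
  apply: leq_word_card => w sw.
  by rewrite /= sw truncn_ge_nat.
rewrite natrX exprS ler_pM2l ?ltr0n // -powR_mulrn //.
by apply: ler_powR; rewrite ?ler1n // truncn_le.
Qed.

Theorem theorem23 (R : realType) (U : optimal_machine) (d beta : R)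
    (d_lt1 : d < 1) (beta_gt : 2 `^ d < beta) (beta_lt2 : beta < 2) :
  exists (C : R) (X : set config),
    [/\ 0 < C,
        subshift X,
        ((ln beta)%:E <= entropy R X)%E
      & forall (tau : pattern) (x : config),
          connected_pattern tau -> X x -> appears tau x ->
          d * (psize tau)%:R - C < (K U (pattern_word tau))%:R].
Proof.
set D := 2 `^ d in beta_gt *.
have D0 : 0 < D by rewrite powR_gt0.
have b0 : 0 < beta := lt_trans D0 beta_gt.
pose s := (1 - D / beta) * (2 - beta).
have q1 : 0 < 1 - D / beta by rewrite subr_gt0 ltr_pdivrMr // mul1r.
have s0 : 0 < s by rewrite mulr_gt0 // subr_gt0.
(* The growth condition reads [2 * D / s <= 2 ^+ c]; it suffices that [c] exceeds [2 * D / s], as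
   [c < 2 ^ c]. *)
pose c := (Num.truncn (2 * D / s)).+1.
have hc : 2 / 2 ^+ c * D / (1 - D / beta) <= 2 - beta.
  have : 2 * D / s <= 2 ^+ c.
    apply: le_trans (ltW (truncnS_gt _)) _.
    by rewrite -/c -natrX ler_nat ltnW // ltn_expl.
  rewrite ler_pdivrMr // ler_pdivrMr // mulrAC ler_pdivrMr ?exprn_gt0 //.
  by rewrite /s [_ * (2 - beta)]mulrC [2 ^+ c * _]mulrC.
pose bad : pred (seq bool) :=
  [pred w | (K U w)%:R <= d * (size w)%:R - c%:R :> R].
(* The threshold for the empty word is [- c < 0], because [c] is a successor. *)
have bad0 : ~~ bad [::].
  by rewrite /bad /= mulr0 sub0r -ltNge (@lt_le_trans _ _ 0) // oppr_lt0 ltr0n.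
pose F : set pattern :=
  [set f | connected_pattern f /\ bad (pattern_word f)]%classic.
pose X : set config := [set x | forall f, F f -> ~ appears f x]%classic.
have FX (x : config) : (forall g m, ~~ bad (subword x g m)) -> X x.
  move=> xgood f [fc fbad] fx; have [g fg] := pattern_word_subword fc fx.
  by move: fbad; rewrite fg; apply/negP.
exists c%:R, X; split; first by rewrite ltr0n.
- by exists F.
- apply: entropy_ge => // n.
  have A0 : 0 <= 2 / 2 ^+ c :> R by rewrite divr_ge0 // exprn_ge0.
  have D0b : 0 < D < beta by rewrite D0.
  have hbad m := word_card_compressible U d c m.
  have := word_card_biextendable n b0 (avoids_growth A0 D0b hc bad0 hbad).
  move=> /le_trans; apply; rewrite ler_nat; apply: leq_word_card => w _.
  move=> /biextendable_config[x [xgood [g wg]]].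
  by apply/asboolP; exists x; [exact: FX | exists g].
- move=> tau x tc Xx taux; rewrite ltNge -size_pattern_word; apply/negP => h.
  by apply: (Xx tau) taux.
Qed.
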